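(* For all $n\ge1$, $\operatorname{tr}R^{(W(n))}=1$.
   Context: A 4-tuple $(x,y,a,b)$ is an edge from peg $x$ at height $a$ to peg $y$ at height $b$ (height 1 = bottom). $W(n)$ is the set (a web world) of web diagrams on $n+2$ pegs $D=\{(i,i+1,x_i,y_{i+1}):1\le i\le n+1\}$ with $x_1=y_{n+2}=1$ and $\{x_i,y_i\}=\{1,2\}$ for $2\le i\le n+1$ (a chain of $n+1$ edges between consecutive pegs, with the two endpoints on each inner peg in either order). Reconstruction: $D\oplus D'=D\cup\{(x',y',a'+p_{x'}(D),b'+p_{y'}(D)):(x',y',a',b')\in D'\}$, $p_i(D)$ the number of endpoints of $D$ on peg $i$; $\mathrm{rel}(X)$ relabels heights of endpoints of edges of $X$ on each peg by $1,\dots,\ell_i$ preserving relative order; an $\ell$-colouring of $D$ is a surjection $c$ from its edges onto $\{1,\dots,\ell\}$, and $\mathcal{R}(D,c)=\mathrm{rel}(D_c(1))\oplus\cdots\oplus\mathrm{rel}(D_c(\ell))$ with $D_c(t)$ the edges of colour $t$. $f(D_1,D_2,\ell)$ is the number of $\ell$-colourings $c$ of $D_1$ with $\mathcal{R}(D_1,c)=D_2$; the web-mixing matrix $R^{(W)}$ is indexed by $W\times W$ with $R^{(W)}_{D_1,D_2}=\sum_{\ell\ge1}\frac{(-1)^{\ell-1}}{\ell}f(D_1,D_2,\ell)$. *)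

(* Defs.v *)
From mathcomp Require Import all_boot all_order all_algebra.
From mathcomp Require Import finmap.

Set Implicit Arguments.
Unset Strict Implicit.
Unset Printing Implicit Defensive.

Import GRing.Theory.
Local Open Scope fset_scope.

(* (x, y, a, b) is the edge from peg x at height a to peg y at height b. *)
Notation edge := (nat * nat * nat * nat)%type.

Definition lpeg (e : edge) : nat := e.1.1.1.
Definition rpeg (e : edge) : nat := e.1.1.2.
Definition lheight (e : edge) : nat := e.1.2.
Definition rheight (e : edge) : nat := e.2.

Notation diagram := {fset edge}.

Definition heights (D : diagram) (i : nat) : seq nat :=
  [seq lheight e | e <- D & lpeg e == i] ++
  [seq rheight e | e <- D & rpeg e == i].

Definition npeg (D : diagram) (i : nat) : nat := size (heights D i).

Definition shift_edge (D : diagram) (e : edge) : edge :=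
  (lpeg e, rpeg e, lheight e + npeg D (lpeg e), rheight e + npeg D (rpeg e))%N.

Definition oplus (D D' : diagram) : diagram :=
  D `|` [fset shift_edge D e | e in D'].

(* The rank of height h among the endpoints of X on peg i; when those have
   pairwise distinct heights, this is the order-preserving bijection onto
   {1, ..., npeg X i}. *)
Definition rank (X : diagram) (i h : nat) : nat :=
  (count (fun h' => h' < h) (heights X i)).+1.

Definition rel_edge (X : diagram) (e : edge) : edge :=
  (lpeg e, rpeg e, rank X (lpeg e) (lheight e), rank X (rpeg e) (rheight e)).

Definition rel_diag (X : diagram) : diagram :=
  [fset rel_edge X e | e in X].

(* Colours are 0, ..., l - 1 instead of 1, ..., l. *)
Definition colouring (D : diagram) (l : nat) (c : {ffun D -> 'I_l}) : bool :=
  [forall t, exists e, c e == t].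

Definition colour_class (D : diagram) (l : nat) (c : {ffun D -> 'I_l})
    (t : 'I_l) : diagram :=
  [fset val e | e : D & c e == t].

(* The bigop nests to the right and ends with the neutral fset0; oplus is
   associative on diagrams whose heights on each peg i are 1, ..., npeg i. *)
Definition reconstruct (D : diagram) (l : nat) (c : {ffun D -> 'I_l}) :
    diagram :=
  \big[oplus/fset0]_(t < l) rel_diag (colour_class c t).

Definition ncol (D1 D2 : diagram) (l : nat) : nat :=
  #|[set c : {ffun D1 -> 'I_l} | colouring c && (reconstruct c == D2)]|.

Lemma ncol_eq0 (D1 D2 : diagram) (l : nat) :
  #|` D1| < l -> ncol D1 D2 l = 0.
Proof.
move=> lt_D1l; apply/eqP; rewrite cards_eq0; apply/eqP/setP => c.
rewrite !inE; apply/negbTE; apply: contraL lt_D1l => /andP[/forallP c_surj _].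
rewrite -leqNgt cardfE -[l in (l <= _)%N]card_ord.
apply: leq_trans (leq_image_card c predT); apply/subset_leq_card/subsetP => t _.
by have /existsP[e /eqP <-] := c_surj t; apply: image_f.
Qed.

Local Open Scope ring_scope.

(* The sum over all l >= 1 stops at the number of edges of D1, by ncol_eq0. *)
Definition mixing_entry (D1 D2 : diagram) : rat :=
  \sum_(1 <= l < #|` D1|.+1) (-1) ^+ l.-1 / l%:R * (ncol D1 D2 l)%:R.

Definition mixing_matrix (W : {fset diagram}) : 'M[rat]_#|{: W}| :=
  \matrix_(i, j) mixing_entry (val (enum_val i)) (val (enum_val j)).

Local Close Scope ring_scope.

Definition chain (n : nat) (x y : nat -> nat) : diagram :=
  [fset ((i, i.+1, x i, y i.+1) : edge) | i in iota 1 n.+1].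

Definition chain_heights (n : nat) (x y : nat -> nat) : bool :=
  [&& x 1 == 1, y n.+2 == 1 &
      all (fun i => [fset x i; y i] == [fset 1; 2]) (iota 2 n)].

Definition peg_height (n : nat) (f : {ffun 'I_n.+3 -> 'I_3}) (i : nat) : nat :=
  f (inord i).

(* x and y range over finite functions so that W(n) is a finite set by
   construction; web_worldP is the unbounded description. *)
Definition web_world (n : nat) : {fset diagram} :=
  [fset chain n (peg_height xy.1) (peg_height xy.2)
     | xy : {ffun 'I_n.+3 -> 'I_3} * {ffun 'I_n.+3 -> 'I_3}
     & chain_heights n (peg_height xy.1) (peg_height xy.2)].

Lemma web_worldP (n : nat) (D : diagram) :
  reflect (exists x y : nat -> nat,
             [/\ x 1 = 1, y n.+2 = 1,
                 forall i, 2 <= i <= n.+1 -> [fset x i; y i] = [fset 1; 2] &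
                 D = chain n x y])
          (D \in web_world n).
Proof.
apply: (iffP (imfsetP _ _ _ _)) => [[xy /= xyP ->]|[x [y [x1 yn xyP ->]]]].
  exists (peg_height xy.1), (peg_height xy.2).
  move: xyP; rewrite inE => /and3P[/eqP x1 /eqP yn /allP xyP].
  split=> // i i_bnd; apply/eqP/xyP.
  by rewrite mem_iota add2n ltnS.
have xyle i : 2 <= i <= n.+1 -> (x i < 3) && (y i < 3).
  move=> /xyP /fsetP xyi.
  have := xyi (x i); have := xyi (y i); rewrite !inE !eqxx orbT /=.
  by do 2![move=> /esym /orP[] /eqP ->].
pose fx : {ffun 'I_n.+3 -> 'I_3} := [ffun i : 'I_n.+3 => inord (x i)].
pose fy : {ffun 'I_n.+3 -> 'I_3} := [ffun i : 'I_n.+3 => inord (y i)].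
have fxE i : 1 <= i <= n.+1 -> peg_height fx i = x i :> nat.
  move=> /andP[i_gt0 i_le]; rewrite /peg_height ffunE (@inordK n.+2) ?ltnS ?(leq_trans i_le)//.
  rewrite inordK //; move: i_gt0; rewrite leq_eqVlt => /orP[/eqP <-|i_gt1].
    by rewrite x1.
  by have /andP[] := xyle i (introT andP (conj i_gt1 i_le)).
have fyE i : 2 <= i <= n.+2 -> peg_height fy i = y i :> nat.
  move=> /andP[i_gt1 i_le]; rewrite /peg_height ffunE (@inordK n.+2) ?ltnS //.
  rewrite inordK //; move: i_le; rewrite leq_eqVlt => /orP[/eqP ->|i_le].
    by rewrite yn.
  by have /andP[] := xyle i (introT andP (conj i_gt1 i_le)).
exists (fx, fy) => /=.
  rewrite inE; apply/and3P; split; rewrite /= ?fxE ?fyE ?x1 ?yn ?leqnn //.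
  apply/allP => i; rewrite mem_iota add2n ltnS => /andP[i_gt1 i_le].
  rewrite fxE ?fyE ?i_le ?i_gt1 ?(ltnW i_gt1) ?(leqW i_le) //.
  by apply/eqP/xyP; rewrite i_gt1.
apply: eq_in_imfset => // i i_in.
have : i \in iota 1 n.+1 by [].
rewrite mem_iota add1n ltnS => i_bnd.
by rewrite fxE // fyE.
Qed.

(* Main.v *)
Require Import Defs.
From mathcomp Require Import all_boot all_order all_algebra.
From mathcomp Require Import finmap zify ring.

(* A diagram of W(n) is an orientation of a path whose vertices are the n+1
   edges of the chain: on each inner peg one of two consecutive edges ends
   lower.  Reconstruction keeps this order when the two edges have the same
   colour and otherwise lets the smaller colour win, so R(D, c) = D iff at each
   inner peg the colours agree or are ordered as in D.  Hence a colouring c is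
   counted in tr R by 2 ^ (number of consecutive edges of equal colour)
   diagrams.  Summed over all maps to a k-set these weights give k (k + 1) ^ n;
   Moebius inversion over the image gives the sum over the surjections onto
   an l-set, which obeys the recursion of [wsurj], and along that recursion the
   alternating sum with coefficients (-1) ^ (l - 1) / l telescopes to 1. *)

Set Implicit Arguments.
Unset Strict Implicit.
Unset Printing Implicit Defensive.

Import GRing.Theory Num.Theory.

(** * Weighted surjection numbers *)

(* The total weight of the surjections of n + 1 points onto l colours, by
   [sum_eq_weight_image]. *)
Fixpoint wsurj (n l : nat) : nat :=
  if n is n'.+1 then l.+1 * wsurj n' l + l * wsurj n' l.-1 else l == 1.

Lemma wsurj0 (n : nat) : wsurj n 0 = 0.
Proof. by elim: n => //= n ->. Qed.

Lemma wsurj_gt (n l : nat) : n.+1 < l -> wsurj n l = 0.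
Proof.
elim: n l => [|n IHn] l /=; first by case: l => [|[]].
by move=> lt_nl; rewrite !IHn ?muln0 //; lia.
Qed.

(** Induction on [n]: the new factor [k + 1] splits as [(i + 1) + (k - i)], and absorption, [(k - i)
    * 'C(k, i) = (i + 1) * 'C(k, i + 1)], turns the second part into the [wsurj n l.-1] term of the
    recursion at [l = i + 1]. *)
Lemma sum_bin_wsurj (n k : nat) :
  \sum_(l < k.+1) 'C(k, l) * wsurj n l = k * k.+1 ^ n.
Proof.
elim: n => [|n IHn] /=.
  rewrite expn0 muln1; case: k => [|k]; first by rewrite big_ord1.
  rewrite 2!big_ord_recl big1 ?bin0 ?bin1 /= ?muln0 ?muln1 ?addn0 ?add0n //.
  by move=> i _; rewrite /= muln0.
rewrite expnSr mulnA -IHn big_distrl /=.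
under eq_bigr do rewrite mulnDr.
rewrite big_split /= [X in _ + X]big_ord_recl mul0n muln0 add0n.
(* Here [bump 0 i] is [i + 1]; the extra term [i = k] on the right vanishes. *)
have -> : \sum_(i < k) 'C(k, bump 0 i) * (bump 0 i * wsurj n (bump 0 i).-1) =
          \sum_(i < k.+1) (k - i) * 'C(k, i) * wsurj n i.
  rewrite big_ord_recr /= subnn !mul0n addn0; apply: eq_bigr => i _.
  by rewrite /bump leq0n add1n /= -mul_bin_left mulnA [X in X * _ = _]mulnC.
rewrite -big_split /=; apply: eq_bigr => i _.
have := ltn_ord i; move: (wsurj n i) ('C(k, i)) => a b lt_ik.
rewrite -[X in _ = _ * X](_ : i.+1 + (k - i) = k.+1); last by lia.
by ring.
Qed.

(** * Maps weighted by equal neighbours *)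

Lemma sum_subset_card (T : finType) (A : {set T}) (g : nat -> nat) :
  \sum_(B : {set T} | B \subset A) g #|B| =
  \sum_(l < #|A|.+1) 'C(#|A|, l) * g l.
Proof.
rewrite (partition_big (fun B : {set T} => inord #|B| : 'I_#|A|.+1) xpredT) //=.
apply: eq_bigr => l _.
rewrite -cards_draws -sum_nat_const.
apply: congr_big => //; last first.
  move=> B /andP[/subset_leq_card sBA /eqP <-].
  by rewrite inordK.
move=> B; rewrite inE; apply: andb_id2l => /subset_leq_card sBA.
by rewrite -val_eqE /= inordK.
Qed.

Definition ffun_cons (T : Type) (n : nat) (p : T * {ffun 'I_n -> T}) :
    {ffun 'I_n.+1 -> T} :=
  [ffun i => if unlift ord0 i is Some j then p.2 j else p.1].

Lemma ffun_cons_bij (T : Type) (n : nat) : bijective (@ffun_cons T n).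
Proof.
exists (fun f : {ffun 'I_n.+1 -> T} => (f ord0, [ffun j => f (lift ord0 j)])).
  move=> [t g]; rewrite /ffun_cons ffunE unlift_none; congr pair.
  by apply/ffunP => j; rewrite !ffunE liftK.
move=> f; apply/ffunP => i; rewrite /ffun_cons ffunE /=.
by case: unliftP => [j|] -> //; rewrite ffunE.
Qed.

Definition eq_weight (T : eqType) (n : nat) (f : {ffun 'I_n.+1 -> T}) : nat :=
  \prod_(i < n) (f (widen_ord (leqnSn n) i) == f (lift ord0 i)).+1.

(** Prepending [a] to [g] doubles the weight if [a = g ord0] and keeps it otherwise, so summing over
    [a] in [A] multiplies by [#|A| + 1], whatever [g] is. *)
Lemma sum_eq_weight_ffun_on (T : finType) (A : {set T}) (n : nat) :
  \sum_(f : {ffun 'I_n.+1 -> T} | f \in ffun_on (mem A)) eq_weight f =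
  #|A| * #|A|.+1 ^ n.
Proof.
elim: n => [|n IHn].
  under eq_bigr do rewrite /eq_weight big_ord0.
  by rewrite sum1_card card_ffun_on card_ord expn1 expn0 muln1.
rewrite (reindex _ (onW_bij _ (ffun_cons_bij T n.+1))) /=.
have onE (p : T * {ffun 'I_n.+1 -> T}) : (ffun_cons p \in ffun_on (mem A)) =
    (p.1 \in A) && (p.2 \in ffun_on (mem A)).
  apply/ffun_onP/andP => [onA|[p1A /ffun_onP p2A] i].
    split; first by have := onA ord0; rewrite ffunE unlift_none.
    by apply/ffun_onP => j; have := onA (lift ord0 j); rewrite ffunE liftK.
  by rewrite ffunE; case: unliftP.
have weightE (p : T * {ffun 'I_n.+1 -> T}) : eq_weight (ffun_cons p) =
    (p.1 == p.2 ord0).+1 * eq_weight p.2.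
  rewrite /eq_weight big_ord_recl; congr muln.
    by rewrite !ffunE liftK (_ : widen_ord _ _ = ord0) ?unlift_none //; exact: val_inj.
  apply: eq_bigr => i _; rewrite !ffunE liftK.
  rewrite (_ : widen_ord _ _ = lift ord0 (widen_ord (leqnSn n) i)) ?liftK //.
  exact: val_inj.
rewrite (eq_bigl _ _ onE) (eq_bigr _ (fun p _ => weightE p)).
rewrite -(pair_big (fun a => a \in A)
  (fun g : {ffun 'I_n.+1 -> T} => g \in ffun_on (mem A))
  (fun a g => (a == g ord0).+1 * eq_weight g)) /=.
rewrite exchange_big /= expnSr mulnA -IHn big_distrl /=.
apply: eq_bigr => g /ffun_onP gA; rewrite -big_distrl mulnC /=; congr muln.
under eq_bigr do rewrite -addn1.
rewrite big_split /= sum1_card (bigD1 (g ord0)) ?gA //= eqxx big1.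
  by rewrite addn0 add1n.
by move=> a /andP[_ /negbTE ->].
Qed.

(** Moebius inversion as strong induction on [#|A|]: summed over all subsets of [A], both sides give
    [#|A| * #|A|.+1 ^ n], and the terms of the proper subsets cancel. *)
Lemma sum_eq_weight_image (T : finType) (A : {set T}) (n : nat) :
  \sum_(f : {ffun 'I_n.+1 -> T} | f @: setT == A) eq_weight f = wsurj n #|A|.
Proof.
have [k] := ubnP #|A|; elim: k A => // k IHk A /ltnSE le_Ak.
have := sum_eq_weight_ffun_on A n.
rewrite -sum_bin_wsurj -sum_subset_card.
rewrite (partition_big (fun f : {ffun 'I_n.+1 -> T} => f @: setT)
  (fun B : {set T} => B \subset A)) /=; last first.
  by move=> f /ffun_onP fA; apply/subsetP => _ /imsetP[i _ ->]; apply: fA.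
have inner (B : {set T}) : B \subset A ->
    \sum_(f : {ffun 'I_n.+1 -> T} | (f \in ffun_on (mem A)) && (f @: setT == B))
       eq_weight f =
    \sum_(f : {ffun 'I_n.+1 -> T} | f @: setT == B) eq_weight f.
  move=> /subsetP sBA; apply: eq_bigl => f; apply: andb_idl => /eqP fB.
  by apply/ffun_onP => i; apply: sBA; rewrite -fB imset_f.
rewrite (eq_bigr _ inner) (bigD1 A) //= [RHS](bigD1 A) //=.
rewrite [X in _ + X = _](eq_bigr (fun B : {set T} => wsurj n #|B|)).
  by move/addIn.
move=> B /andP[sBA neBA]; apply: IHk; apply: leq_trans le_Ak.
by apply: proper_card; rewrite properEneq neBA.
Qed.

(** * The alternating sum *)

Local Open Scope ring_scope.

Lemma alternating_sum_wsurj (n N : nat) : (n < N)%N ->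
  \sum_(1 <= l < N.+1) (-1) ^+ l.-1 / l%:R * (wsurj n l)%:R = 1 :> rat.
Proof.
rewrite big_add1 /= big_mkord.
elim: n => [|n IHn] lt_nN.
  case: N lt_nN => // N _; rewrite big_ord_recl big1 /= ?addr0 ?divr1 ?mulr1 //.
  by move=> i _; rewrite mulr0.
rewrite -[RHS](IHn (ltnW lt_nN)); apply/eqP; rewrite -subr_eq0 -sumrB; apply/eqP.
(* By the recursion, the [l]-th terms for [n + 1] and [n] differ by
   [(-1) ^+ l * (wsurj n l.+1 + wsurj n l)]: the denominator cancels. *)
pose a l : rat := (-1) ^+ l * (wsurj n l)%:R.
rewrite (eq_bigr (fun l : 'I_N => - (a l.+1 - a l))); last first.
  move=> l _; rewrite /a /= natrD !natrM exprS -[l.+2%:R]natr1.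
  have : (l.+1%:R : rat) != 0 by rewrite pnatr_eq0.
  move: (l.+1%:R : rat) => u u0; field.
  exact: u0.
rewrite sumrN -(big_mkord xpredT (fun l => a l.+1 - a l)) telescope_sumr //.
(* Both ends vanish, the upper one because [n.+1 < N]. *)
by rewrite /a wsurj0 (@wsurj_gt n N) ?mulr0 ?subrr ?oppr0.
Qed.

Local Close Scope ring_scope.

(** * Sub-chains and their reconstruction *)

Local Open Scope fset_scope.
Local Open Scope nat_scope.

(** [chain n] is the case [s = iota 1 n.+1]; colour classes and their relabellings are sub-chains
    too. *)
Definition subchain (s : seq nat) (x y : nat -> nat) : diagram :=
  [fset ((i, i.+1, x i, y i.+1) : edge) | i in s].

Lemma filter_pred1_nseq (T : eqType) (s : seq T) (a : T) :
  uniq s -> filter (pred1 a) s = nseq (a \in s) a.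
Proof.
move=> s_uniq; case: (boolP (a \in s)) => [|aNs].
  exact: filter_pred1_uniq.
apply/eqP; rewrite -[_ == _]negbK -has_filter has_pred1.
exact: aNs.
Qed.

Lemma subchain_edge_inj (x y : nat -> nat) :
  injective (fun i : nat => (i, i.+1, x i, y i.+1)).
Proof. by move=> i j []. Qed.

(** Only edges [i] and [i - 1] meet peg [i]. The guard [0 < i] keeps the truncated predecessor of 0
    from naming edge 0. *)
Lemma heights_subchain (s : seq nat) (x y : nat -> nat) (i : nat) :
  perm_eq (heights (subchain s x y) i)
    (nseq (i \in s) (x i) ++ nseq ((0 < i) && (i.-1 \in s)) (y i)).
Proof.
pose f j : edge := (j, j.+1, x j, y j.+1).
pose L := enum_finmem (mem s).
have Lu : uniq L by apply: enum_finmem_uniq.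
have LE j : (j \in L) = (j \in s) by rewrite enum_finmemE.
have perm_f : perm_eq (subchain s x y) [seq f j | j <- L].
  by apply: enum_imfset => j k _ _ /subchain_edge_inj.
apply: perm_cat.
  apply: perm_trans (perm_map _ (perm_filter _ perm_f)) _.
  rewrite filter_map -map_comp.
  rewrite (eq_filter (a2 := pred1 i)) // filter_pred1_nseq // map_nseq LE.
  by [].
apply: perm_trans (perm_map _ (perm_filter _ perm_f)) _.
rewrite filter_map -map_comp.
case: i => [|i] /=; first by rewrite (eq_filter (a2 := pred0)) // filter_pred0.
rewrite (eq_filter (a2 := pred1 i)) //.
by rewrite filter_pred1_nseq // map_nseq LE.
Qed.

Lemma npeg_subchain (s : seq nat) (x y : nat -> nat) (i : nat) :
  npeg (subchain s x y) i = (i \in s) + ((0 < i) && (i.-1 \in s)).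
Proof.
by rewrite /npeg (perm_size (heights_subchain s x y i)) size_cat !size_nseq.
Qed.

Lemma rank_subchain (s : seq nat) (x y : nat -> nat) (i h : nat) :
  rank (subchain s x y) i h =
    ((i \in s) && (x i < h) + ((0 < i) && (i.-1 \in s)) && (y i < h)).+1.
Proof.
rewrite /rank (permP (heights_subchain s x y i)) count_cat !count_nseq.
by rewrite -!mulnb ![(_ < h) * _]mulnC.
Qed.

Lemma rel_diag_subchain (s : seq nat) (x y : nat -> nat) :
  rel_diag (subchain s x y) =
  subchain s (fun i => rank (subchain s x y) i (x i))
             (fun i => rank (subchain s x y) i (y i)).
Proof. by rewrite /rel_diag {2}/subchain -imfset_comp. Qed.

Lemma subchainP (s : seq nat) (x y : nat -> nat) (e : edge) :
  reflect (exists2 i, i \in s & e = (i, i.+1, x i, y i.+1))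
          (e \in subchain s x y).
Proof. exact: imfsetP. Qed.

Lemma eq_in_subchain (s : seq nat) (x y x' y' : nat -> nat) :
  {in s, x =1 x'} -> {in s, forall i, y i.+1 = y' i.+1} ->
  subchain s x y = subchain s x' y'.
Proof.
by move=> eqx eqy; apply: eq_in_imfset => i si; rewrite eqx ?eqy.
Qed.

Lemma subchain_inj (s : seq nat) (x y x' y' : nat -> nat) :
  subchain s x y = subchain s x' y' ->
  {in s, forall i, x i = x' i /\ y i.+1 = y' i.+1}.
Proof.
move=> eqD i si.
have : ((i, i.+1, x i, y i.+1) : edge) \in subchain s x y.
  by apply/subchainP; exists i.
by rewrite eqD => /subchainP[j _ [<- _ -> ->]].
Qed.

(* The nesting of the bigop to the right makes every class be shifted by the
   classes that precede it, so associativity of [oplus] is not needed. *)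
Lemma big_oplus_subchain (s : seq nat) (c : nat -> nat) (x y : nat -> nat -> nat)
    (a b : nat) :
  let X t := subchain [seq i <- s | c i == t] (x t) (y t) in
  \big[oplus/fset0]_(a <= t < b) X t =
  subchain [seq i <- s | a <= c i < b]
    (fun i => x (c i) i + \sum_(a <= t < c i) npeg (X t) i)
    (fun i => y (c i.-1) i + \sum_(a <= t < c i.-1) npeg (X t) i).
Proof.
move=> X; have [k le_ba] : exists k, b <= a + k by exists b; lia.
elim: k a le_ba => [|k IHk] a le_ba.
  rewrite addn0 in le_ba; rewrite big_geq //; apply/esym/fsetP => e.
  rewrite inE; apply/negP => /imfsetP[i /=]; rewrite mem_filter; lia.
have [le_b|lt_ab] := leqP b a; first by apply: (IHk); lia.
rewrite big_ltn // IHk ?addSnnS //; apply/fsetP => e; rewrite inE.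
apply/orP/imfsetP => [[] | [i /=]].
- case/imfsetP=> i /=; rewrite mem_filter => /andP[/eqP cia si] ->.
  exists i; first by rewrite /= mem_filter cia leqnn lt_ab.
  by rewrite /= cia big_geq // big_geq // !addn0.
- case/imfsetP=> _ /= /imfsetP[i /= + ->] ->.
  rewrite mem_filter => /andP[/andP[lt_a lt_b] si].
  exists i; first by rewrite /= mem_filter (ltnW lt_a) lt_b.
  by rewrite /shift_edge /= !(big_ltn lt_a) !(addnC (npeg _ _)) !addnA.
rewrite mem_filter => /andP[/andP[le_a lt_b] si] ->.
move: (le_a); rewrite leq_eqVlt => /orP[/eqP cia|lt_a]; [left|right].
  apply/imfsetP; exists i; first by rewrite /= mem_filter -cia eqxx.
  by rewrite /= -cia big_geq // big_geq // !addn0.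
apply/imfsetP.
exists (i, i.+1, x (c i) i + \sum_(a.+1 <= t < c i) npeg (X t) i,
  y (c i) i.+1 + \sum_(a.+1 <= t < c i) npeg (X t) i.+1).
  by apply/imfsetP; exists i; rewrite //= mem_filter lt_a lt_b.
by rewrite /shift_edge /= !(big_ltn lt_a) !(addnC (npeg _ _)) !addnA.
Qed.

Lemma sum_nat_eq_ltn (a m : nat) : \sum_(0 <= t < m) (a == t) = (a < m).
Proof.
rewrite big_mkord; case: ltnP => [lt_am|le_ma].
  rewrite (bigD1 (Ordinal lt_am)) //= eqxx big1 // => t.
  by rewrite -val_eqE eq_sym /= => /negbTE ->.
by rewrite big1 // => t _; rewrite gtn_eqF // (leq_trans (ltn_ord t)).
Qed.

(** An endpoint gets height 2 iff the other edge at its peg has a smaller colour, or the same colour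
    and a lower endpoint there. Absent edges have colour at least [l], so they never count as
    lower. *)
Lemma big_oplus_rel_subchain (s : seq nat) (l : nat) (c x y : nat -> nat) :
  0 \notin s -> (forall i, (c i < l) = (i \in s)) ->
  \big[oplus/fset0]_(0 <= t < l)
     rel_diag (subchain [seq i <- s | c i == t] x y) =
  subchain s
    (fun i => ((c i.-1 == c i) && (y i < x i) + (c i.-1 < c i)).+1)
    (fun i => ((c i.-1 == c i) && (x i < y i) + (c i < c i.-1)).+1).
Proof.
move=> s0 c_lt.
under eq_bigr do rewrite rel_diag_subchain.
rewrite (big_oplus_subchain s c
  (fun t i => rank (subchain [seq i <- s | c i == t] x y) i (x i))
  (fun t i => rank (subchain [seq i <- s | c i == t] x y) i (y i))).
have mem_s t i : t < l -> (i \in [seq i <- s | c i == t]) = (c i == t).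
  by move=> lt_tl; rewrite mem_filter; apply: andb_idr => /eqP; rewrite -c_lt => ->.
have -> : [seq i <- s | 0 <= c i < l] = s.
  by apply/all_filterP/allP => i; rewrite /= c_lt.
have npegE X Y i t : 0 < i -> t < l ->
    npeg (subchain [seq i <- s | c i == t] X Y) i = (c i == t) + (c i.-1 == t).
  by move=> i0 lt_tl; rewrite npeg_subchain !mem_s // i0.
apply: eq_in_subchain => i si.
  have i0 : 0 < i by case: (i) si => //; rewrite (negbTE s0).
  have ci : c i < l by rewrite c_lt.
  rewrite (eq_big_nat _ _ (F2 := fun t => (c i == t) + (c i.-1 == t))); last first.
    by move=> t /andP[_ lt_t]; rewrite npegE // (ltn_trans lt_t).
  rewrite big_split /= !sum_nat_eq_ltn ltnn add0n.
  by rewrite rank_subchain !mem_s // i0 ltnn andbF add0n.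
have ci : c i < l by rewrite c_lt.
rewrite /= (eq_big_nat _ _ (F2 := fun t => (c i.+1 == t) + (c i == t))); last first.
  by move=> t /andP[_ lt_t]; rewrite npegE // (ltn_trans lt_t).
rewrite big_split /= !sum_nat_eq_ltn ltnn addn0.
by rewrite rank_subchain !mem_s // ltnn andbF addn0 [c i.+1 == _]eq_sym.
Qed.

(** * Colours and orientations of a chain *)

(* Edges outside the chain get the colour [l], above all actual colours; this
   makes the outer pegs behave like inner ones. *)
Definition colour_at (n l : nat) (c : {ffun 'I_n.+1 -> 'I_l}) (i : nat) : nat :=
  if 0 < i then oapp (fun j => val (c j)) l (insub i.-1) else l.

Lemma colour_atS (n l : nat) (c : {ffun 'I_n.+1 -> 'I_l}) (j : 'I_n.+1) :
  colour_at c j.+1 = c j.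
Proof. by rewrite /colour_at /= valK. Qed.

Lemma colour_at_lt (n l : nat) (c : {ffun 'I_n.+1 -> 'I_l}) (i : nat) :
  (colour_at c i < l) = (i \in iota 1 n.+1).
Proof.
rewrite mem_iota /colour_at; case: i => [|i] /=; first by rewrite ltnn.
rewrite add1n ltnS; case: insubP => [j lt_in _ /=|]; first by rewrite ltn_ord lt_in.
by rewrite /= ltnn => /negbTE ->.
Qed.

(* [up o i] says that edge [i - 1] ends below edge [i] on peg [i]; the values on
   the outer pegs 1 and [n + 2] are those giving height 1 in [orient_diag]. *)
Definition up (n : nat) (o : {ffun 'I_n -> bool}) (i : nat) : bool :=
  (1 < i) && oapp o true (insub (i - 2)).

Lemma up_inner (n : nat) (o : {ffun 'I_n -> bool}) (j : 'I_n) : up o j.+2 = o j.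
Proof. by rewrite /up /= subn2 /= valK. Qed.

Lemma up_last (n : nat) (o : {ffun 'I_n -> bool}) : up o n.+2 = true.
Proof. by rewrite /up /= subn2 /= insubF // ltnn. Qed.

Definition orient_diag (n : nat) (o : {ffun 'I_n -> bool}) : diagram :=
  chain n (fun i => (up o i).+1) (fun i => (~~ up o i).+1).

Lemma orient_diag_inj (n : nat) : injective (@orient_diag n).
Proof.
move=> o o' /(@subchain_inj (iota 1 n.+1)) eqo; apply/ffunP => j.
have /eqo[+ _] : j.+2 \in iota 1 n.+1 by rewrite mem_iota; have := ltn_ord j; lia.
by rewrite !up_inner; case: (o j) (o' j) => [] [].
Qed.

Lemma card_orient_diag (n : nat) (o : {ffun 'I_n -> bool}) :
  #|` orient_diag o| = n.+1.
Proof.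
rewrite card_imfset; last by move=> i j [].
rewrite -[RHS](size_iota 1); apply/perm_size/uniq_perm.
- exact: enum_finmem_uniq.
- exact: iota_uniq.
by move=> i; rewrite enum_finmemE.
Qed.

Lemma mem_web_world (n : nat) (D : diagram) :
  reflect (exists o : {ffun 'I_n -> bool}, D = orient_diag o)
          (D \in web_world n).
Proof.
apply: (iffP (web_worldP n D)) => [[x [y [x1 yn xy ->]]]|[o ->]]; last first.
  exists (fun i => (up o i).+1), (fun i => (~~ up o i).+1); split=> //.
    by rewrite up_last.
  by move=> i _; case: (up o i) => //=; rewrite fsetUC.
(* The heights on an inner peg leave one bit: whether edge [i] is the upper one on peg [i]. Inner
   pegs start at 2, hence [j.+2]. *)
exists [ffun j : 'I_n => x j.+2 == 2]; set o := finfun _.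
have xyE i : 2 <= i <= n.+1 -> x i = (up o i).+1 /\ y i = (~~ up o i).+1.
  move=> i_bnd; have lt_i : i - 2 < n by lia.
  have -> : up o i = (x i == 2).
    have -> : i = (Ordinal lt_i).+2 by move=> /=; lia.
    by rewrite up_inner ffunE.
  have /fsetP xyi := xy i i_bnd.
  have := xyi (x i); have := xyi (y i); have := xyi 1; have := xyi 2.
  by rewrite !inE; lia.
apply: (@eq_in_subchain (iota 1 n.+1)) => i; rewrite mem_iota => i_bnd.
  by have [->|/xyE[]//] : i = 1 \/ 2 <= i <= n.+1 by lia.
have [->|/xyE[]//] : i = n.+1 \/ 2 <= i.+1 <= n.+1 by lia.
by rewrite up_last.
Qed.

(** * Colourings compatible with an orientation *)

Definition compatible (n : nat) (T : finType) (r : rel T)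
    (o : {ffun 'I_n -> bool}) (c : {ffun 'I_n.+1 -> T}) : bool :=
  [forall j : 'I_n, (c (widen_ord (leqnSn n) j) == c (lift ord0 j)) ||
     (o j == r (c (widen_ord (leqnSn n) j)) (c (lift ord0 j)))].

Section OrientedColourings.

Variables (n : nat) (o : {ffun 'I_n -> bool}).
Local Notation D := (orient_diag o).

Definition edge_index (e : D) : 'I_n.+1 := inord (lpeg (val e)).-1.

Lemma edge_at_proof (j : 'I_n.+1) :
  ((j.+1, j.+2, (up o j.+1).+1, (~~ up o j.+2).+1) : edge) \in D.
Proof.
apply/(@subchainP (iota 1 n.+1)); exists j.+1 => //.
by rewrite mem_iota; have := ltn_ord j; lia.
Qed.

Definition edge_at (j : 'I_n.+1) : D := [` edge_at_proof j].

Lemma edge_atK : cancel edge_at edge_index.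
Proof. by move=> j; rewrite /edge_index /= inord_val. Qed.

Lemma edge_indexK : cancel edge_index edge_at.
Proof.
move=> e; apply: val_inj; have /(@subchainP (iota 1 n.+1))[i] := valP e.
rewrite mem_iota /edge_index => i_bnd -> /=.
by rewrite /lpeg /= inordK ?prednK //; lia.
Qed.

Definition colour_edges (l : nat) (c : {ffun 'I_n.+1 -> 'I_l}) : {ffun D -> 'I_l} :=
  [ffun e => c (edge_index e)].

Lemma colour_edges_bij (l : nat) : bijective (@colour_edges l).
Proof.
exists (fun c : {ffun D -> 'I_l} => [ffun j => c (edge_at j)]) => c;
  by apply/ffunP => j; rewrite !ffunE ?edge_atK ?edge_indexK.
Qed.

Lemma colouring_colour_edges (l : nat) (c : {ffun 'I_n.+1 -> 'I_l}) :
  colouring (colour_edges c) = (c @: setT == setT).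
Proof.
apply/forallP/eqP => [c_surj|c_im t].
  apply/setP => t; rewrite inE; have /existsP[e /eqP <-] := c_surj t.
  by rewrite ffunE imset_f.
have /imsetP[j _ ->] : t \in c @: setT by rewrite c_im.
by apply/existsP; exists (edge_at j); rewrite ffunE edge_atK.
Qed.

Lemma colour_class_colour_edges (l : nat) (c : {ffun 'I_n.+1 -> 'I_l}) (t : 'I_l) :
  colour_class (colour_edges c) t =
  subchain [seq i <- iota 1 n.+1 | colour_at c i == t]
    (fun i => (up o i).+1) (fun i => (~~ up o i).+1).
Proof.
apply/fsetP => e; apply/imfsetP/subchainP => [[f]|[i]].
  rewrite inE ffunE -[in e = _](edge_indexK f); move: (edge_index f) => j /eqP cj ->.
  exists j.+1 => //; rewrite mem_filter colour_atS cj eqxx mem_iota.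
  by have := ltn_ord j; lia.
rewrite mem_filter mem_iota => /andP[/eqP ct i_bnd] ->.
have lt_i : i.-1 < n.+1 by lia.
have iE : i = (Ordinal lt_i).+1 by move=> /=; lia.
exists (edge_at (Ordinal lt_i)) => /=; last by rewrite -iE.
by rewrite inE ffunE edge_atK -val_eqE /= -colour_atS -iE ct.
Qed.

(** Both diagrams are chains on the same pegs, so they are compared height by height; the condition
    at each inner peg is that of [compatible]. *)
Lemma reconstruct_colour_edges (l : nat) (c : {ffun 'I_n.+1 -> 'I_l}) :
  (reconstruct (colour_edges c) == D) =
  compatible (fun s t : 'I_l => s < t) o c.
Proof.
rewrite /reconstruct (eq_bigr _ (fun t _ => congr1 rel_diag
  (colour_class_colour_edges c t))).
rewrite -(big_mkord xpredT (fun t => rel_diag (subchain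
  [seq i <- iota 1 n.+1 | colour_at c i == t]
    (fun i => (up o i).+1) (fun i => (~~ up o i).+1)))).
rewrite big_oplus_rel_subchain; [|by rewrite mem_iota|exact: colour_at_lt].
set d := colour_at c.
have dlt := colour_at_lt c; rewrite -/d in dlt.
have d0 : d 0 = l by [].
have dout : l <= d n.+2 by rewrite leqNgt dlt mem_iota; lia.
have dE j : d (nat_of_ord j).+1 = c j by apply: colour_atS.
have compatE : compatible (fun s t : 'I_l => s < t) o c =
    all (fun i => (d i.-1 == d i) || (up o i == (d i.-1 < d i))) (iota 2 n).
  apply/forallP/allP => [cP i|dP j].
    rewrite mem_iota => i_bnd; have lt_i : i - 2 < n by lia.
    have [j ->] : exists j : 'I_n, i = j.+2.
      by exists (Ordinal lt_i) => /=; lia.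
    by have := cP j; rewrite -up_inner -val_eqE /= -!dE.
  have /dP : j.+2 \in iota 2 n by rewrite mem_iota; have := ltn_ord j; lia.
  by rewrite -up_inner -val_eqE /= -!dE.
rewrite compatE; apply/eqP/allP => [|dP].
  move/(@subchain_inj (iota 1 n.+1)) => eqD i; rewrite mem_iota => i_bnd.
  have /eqD[+ _] : i \in iota 1 n.+1 by rewrite mem_iota; lia.
  by case: (up o i); lia.
(* On the outer pegs the condition is automatic: the absent edge has colour at least [l], and [up]
   is false at peg 1 and true at peg [n + 2]. *)
have {}dP i : 1 <= i <= n.+2 ->
    (d i.-1 == d i) || (up o i == (d i.-1 < d i)).
  move=> i_bnd; have [->|[->|i_in]] : i = 1 \/ i = n.+2 \/ i \in iota 2 n.
    - by rewrite mem_iota; lia.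
    - rewrite d0 /up /=; have := dlt 1; rewrite mem_iota; lia.
    - by rewrite up_last /=; have := dlt n.+1; rewrite mem_iota; lia.
  exact: dP.
apply: (@eq_in_subchain (iota 1 n.+1)) => i; rewrite mem_iota => i_bnd.
  have := dP i; case: (up o i); lia.
by have := dP i.+1; rewrite /=; case: (up o i.+1); lia.
Qed.

Lemma ncol_orient_diag (l : nat) :
  ncol D D l =
  \sum_(c : {ffun 'I_n.+1 -> 'I_l} | c @: setT == setT)
     compatible (fun s t : 'I_l => s < t) o c.
Proof.
rewrite /ncol -sum1_card (reindex _ (onW_bij _ (@colour_edges_bij l))) /=.
rewrite -big_mkcondr; apply: eq_bigl => c.
by rewrite inE colouring_colour_edges reconstruct_colour_edges.
Qed.

End OrientedColourings.

(** The pegs are independent, so the sum factors. A peg allows both bits if its two colours agree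
    and otherwise only the bit given by [r]. *)
Lemma sum_compatible (n : nat) (T : finType) (r : rel T)
    (c : {ffun 'I_n.+1 -> T}) :
  \sum_(o : {ffun 'I_n -> bool}) compatible r o c = eq_weight c.
Proof.
pose F j b := nat_of_bool
  ((c (widen_ord (leqnSn n) j) == c (lift ord0 j)) ||
   (b == r (c (widen_ord (leqnSn n) j)) (c (lift ord0 j)))).
transitivity (\sum_(o : {ffun 'I_n -> bool}) \prod_j F j (o j)).
  apply: eq_bigr => o _; rewrite /compatible /F.
  case: forallP => [oP|/forallP]; first by rewrite big1 // => j _; rewrite oP.
  by rewrite negb_forall => /existsP[j /negbTE oj]; rewrite (bigD1 j) //= oj.
rewrite -bigA_distr_bigA; apply: eq_bigr => j _; rewrite big_bool /F.
by case: (_ == c _) => //=; case: (r _ _).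
Qed.

(** * The trace *)

Local Open Scope ring_scope.

Theorem theorem7p4 (n : nat) (n_ge1 : (1 <= n)%N) :
  \tr (mixing_matrix (web_world n)) = 1.
Proof.
rewrite /mxtrace; under eq_bigr do rewrite mxE.
rewrite -(big_enum_val (fun D : web_world n => mixing_entry (val D) (val D))) /=.
rewrite -(big_seq_fsetE _ _ xpredT (fun D => mixing_entry D D)).
have -> : web_world n = [fset orient_diag o | o : {ffun 'I_n -> bool}].
  apply/fsetP => D; apply/mem_web_world/imfsetP => [[o ->]|[o _ ->]]; by exists o.
rewrite big_imfset /=; last by move=> o o' _ _ /orient_diag_inj.
rewrite big_enum /=.
under eq_bigr do rewrite /mixing_entry card_orient_diag.
(* All diagrams have [n + 1] edges, so [l] has a common range and the two sums can be compared for
   each [l]. *)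
rewrite exchange_big /= -[RHS](alternating_sum_wsurj (ltnSn n)).
apply: eq_bigr => l _; rewrite -mulr_sumr -natr_sum; congr (_ * _%:R).
(* [wsurj n l] is read as the total weight of the maps with image all of ['I_l]. *)
rewrite -[l in RHS]card_ord -cardsT -sum_eq_weight_image.
rewrite (eq_bigr _ (fun o _ => ncol_orient_diag o l)) exchange_big /=.
by apply: eq_bigr => c _; rewrite sum_compatible.
Qed.
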